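(* For every integer $M\ge 0$, the strong and the weak formulation of the Laplacian agree on $\mathcal{D}_M$: for all $u\in\mathcal{D}_M$ and $f\in\mathcal{C}(\Sigma_N^+)$, one has $$\lim_{m\to\infty}\ \max_{p\in V_m\setminus V_M}\left|\frac{H_m u(p)}{\mu([p_1p_2\cdots p_{m+1}])}-f(p)\right|=0$$ (that is, $\Delta u=f$ in the strong sense on $\mathcal{D}_M$) if and only if $$\mathcal{E}(u,v)=-\int_{\Sigma_N^+} f\,v\,\mathrm{d}\mu\qquad\text{for all } v\in dom_M\,\mathcal{E}$$ (that is, $\Delta u=f$ in the weak sense with boundary $V_M$).
   Context: Fix an integer $N\ge 2$, $S=\{1,\dots,N\}$, and let $\Sigma_N^+=\{x=(x_1x_2\cdots):x_i\in S\}$ with the product topology. Cylinder sets: $[p_1\cdots p_m]=\{x: x_1=p_1,\dots,x_m=p_m\}$. $\mu$ is the Borel probability measure with $\mu([p_1\cdots p_m])=N^{-m}$. $\mathcal{C}(\Sigma_N^+)$ is the set of real continuous functions. For $m\ge 0$, $V_m$ is the set of sequences $p=(p_1\cdots p_m\,p_{m+1}\,p_{m+1}\cdots)$ that are constant from position $m+1$ on; $V_0\subset V_1\subset\cdots$, and $V_{-1}=\emptyset$. For $p\in V_m$, $\mathcal{U}_{p,m}=\{q\in V_m: q\ne p,\ q_i=p_i \text{ for } 1\le i\le m\}$ (a set of $N-1$ points; for $m=0$ it is $V_0\setminus\{p\}$). For $p\in\bigcup_m V_m$, $\kappa_p=\min\{j:p\in V_j\}$. For a real function $u$ defined (at least)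 on $V_m$ and $p\in V_m$, the difference operator is $$H_m u(p)=\sum_{j=\kappa_p}^{m}\ \sum_{q\in\mathcal{U}_{p,j}}(u(q)-u(p)).$$ Laplacian: for $u,f\in\mathcal{C}(\Sigma_N^+)$, $\Delta u=f$ means $\lim_{m\to\infty}\max_{p\in V_m\setminus V_{m-1}}\left|\frac{H_mu(p)}{\mu([p_1\cdots p_{m+1}])}-f(p)\right|=0$. $D_\mu$ is the set of $u\in\mathcal{C}(\Sigma_N^+)$ for which such an $f$ exists. For $M\ge0$, $\mathcal{D}_M$ is the set of $u\in D_\mu$ for which there is $f\in\mathcal{C}(\Sigma_N^+)$ with $\Delta u=f$ and $\lim_{m\to\infty}\max_{p\in V_m\setminus V_M}\left|\frac{H_mu(p)}{\mu([p_1\cdots p_{m+1}])}-f(p)\right|=0$. Energy: $\mathcal{E}_{H_m}(u,v)=-\sum_{p\in V_m}u(p)H_mv(p)=\frac12\sum_{i=0}^m\sum_{p\in V_i}\sum_{q\in\mathcal{U}_{p,i}}(u(p)-u(q))(v(p)-v(q))$; $\mathcal{E}(u,v)=\lim_{m\to\infty}\mathcal{E}_{H_m}(u,v)$, $\mathcal{E}(u)=\mathcal{E}(u,u)$; $dom\,\mathcal{E}$ is the set of $u\in\mathcal{C}(\Sigma_N^+)$ with $\mathcal{E}(u)<\infty$ (one has $D_\mu\subset dom\,\mathcal{E}$). For $M\ge 0$, $dom_M\,\mathcal{E}=\{v\in dom\,\mathcal{E}: v|_{V_M}=0\}$. *)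

(* Defs.v *)
From HB Require Import structures.
From mathcomp Require Import all_boot all_order all_algebra finmap.
From mathcomp Require Import all_classical all_reals all_analysis.

Set Implicit Arguments.
Unset Strict Implicit.
Unset Printing Implicit Defensive.

Import Order.TTheory GRing.Theory Num.Theory.
Import numFieldNormedType.Exports.

Local Open Scope classical_set_scope.
Local Open Scope ring_scope.

(* The alphabet is {0, ..., N-1} instead of {1, ..., N}.  The proof of
   [2 <= N] is a parameter of the type because measurable types have to be
   pointed. *)
Definition symbol (N : nat) (N2 : (2 <= N)%N) : Type := 'I_N.

HB.instance Definition _ (N : nat) (N2 : (2 <= N)%N) :=
  Finite.on (symbol N2).
HB.instance Definition _ (N : nat) (N2 : (2 <= N)%N) :=
  isPointed.Build (symbol N2) (Ordinal (ltnW N2)).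

(* Positions start at 0: [x i] is the letter x_(i+1). *)
Definition shift_space (N : nat) (N2 : (2 <= N)%N) : Type :=
  prod_topology (fun _ : nat => discrete_topology (symbol N2)).

HB.instance Definition _ (N : nat) (N2 : (2 <= N)%N) :=
  Pointed.on (shift_space N2).
HB.instance Definition _ (N : nat) (N2 : (2 <= N)%N) :=
  Nbhs.on (shift_space N2).
HB.instance Definition _ (N : nat) (N2 : (2 <= N)%N) :=
  Topological.on (shift_space N2).

Definition borel_shift (N : nat) (N2 : (2 <= N)%N) :=
  g_sigma_algebraType (@open (shift_space N2)).

Section Laplacian.
Variables (R : realType) (N : nat) (N2 : (2 <= N)%N).
Local Notation Sigma := (shift_space N2).
Implicit Types (p q x : Sigma) (u v f : Sigma -> R) (m j M : nat).

(* [cylinder m p] is [p_1 ... p_m]; only the first m letters of p matter. *)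
Definition cylinder m p : set Sigma :=
  [set x | forall i, (i < m)%N -> x i = p i].

Definition V m : set Sigma := [set p | forall i, (m <= i)%N -> p i = p m].

(* V_(m-1), with V_(-1) empty. *)
Definition Vpred m : set Sigma := if m is k.+1 then V k else set0.

Definition U p m : set Sigma :=
  [set q | [/\ V m q, q <> p & forall i, (i < m)%N -> q i = p i]].

(* min {j | p \in V_j}; it is the junk value 0 if p lies in no V_j. *)
Definition kappa p : nat :=
  xget 0%N [set j | V j p /\ forall i, V i p -> (j <= i)%N].

Definition H m u p : R :=
  \sum_(kappa p <= j < m.+1) \sum_(q \in U p j) (u q - u p).

(* The sets V_m are finite, so that [fset_set] and the finitely supported sums
   over V_m and U_(p,m) never take their junk values. *)
Lemma finite_V m : finite_set (V m).
Proof.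
apply: (@sub_finite_set _ _
  (range (fun (w : {ffun 'I_m.+1 -> 'I_N}) (i : nat) => w (inord (minn i m))))).
  move=> p Vp; exists [ffun i : 'I_m.+1 => p (nat_of_ord i)] => //.
  apply/funext => i; rewrite ffunE inordK ?ltnS ?geq_minr//.
  by case: (leqP m i) => // mi; rewrite [RHS]Vp.
exact: finite_image.
Qed.

Lemma finite_U p m : finite_set (U p m).
Proof. by apply: sub_finite_set (finite_V m) => q []. Qed.

Variable mu : probability (borel_shift N2) R.

(* The maximum over p in A of |H_m u(p) / mu([p_1 ... p_(m+1)]) - f(p)|, for a
   finite set A; it is 0 if A is empty. *)
Definition max_error u f m (A : set Sigma) : R :=
  \big[Num.max/0]_(p <- fset_set A)
     `|H m u p / fine (mu (cylinder m.+1 p)) - f p|.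

Definition laplacian_eq u f : Prop :=
  max_error u f m (V m `\` Vpred m) @[m --> \oo] --> (0 : R).

Definition strong_laplacian_eq M u f : Prop :=
  max_error u f m (V m `\` V M) @[m --> \oo] --> (0 : R).

Definition D_mu : set (Sigma -> R) :=
  [set u | continuous u /\ exists f, continuous f /\ laplacian_eq u f].

Definition D_ M : set (Sigma -> R) :=
  [set u | D_mu u /\ exists f,
     [/\ continuous f, laplacian_eq u f & strong_laplacian_eq M u f]].

Definition energy_H m u v : R := - \sum_(p \in V m) (u p * H m v p).

Definition energy u v : \bar R := limn (fun m => (energy_H m u v)%:E).

Definition dom_energy : set (Sigma -> R) :=
  [set u | continuous u /\ (energy u u < +oo)%E].

Definition dom_energy_ M : set (Sigma -> R) :=
  [set v | dom_energy v /\ forall p, V M p -> v p = 0].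

Definition weak_laplacian_eq M u f : Prop :=
  forall v, dom_energy_ M v ->
    energy u v = (- \int[mu]_x (f x * v x)%:E)%E.

End Laplacian.

(* Main.v *)
Require Import Defs.
From mathcomp Require Import all_boot all_order all_algebra finmap.
From mathcomp Require Import all_classical all_reals all_analysis.
From mathcomp Require Import measurable_realfun.

(** Let v be continuous with v = 0 on V_M.  The difference operator H_m is
    symmetric on the finite set V_m ([sum_H_sym]), because its value at p sums
    over the pairs (p, q) related by [edge j], j <= m, and these relations are
    symmetric.  Hence E_(H_m)(u, v) = - sum_(p in V_m) v(p) H_m u(p), where only
    the points p outside V_M contribute.  Each cylinder of length m + 1 contains
    exactly one point of V_m and has measure N^-(m+1), so
    H_m u(p) = N^-(m+1) (f(p) + error) shows that E_(H_m)(u, v) differs from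
    minus the Riemann sum of f v over these cylinders by at most
    sup |v| times the maximal error on V_m \ V_M ([energy_error]).  The Riemann
    sums converge to the integral of f v by dominated convergence
    ([riemann_sum_cvg]); so the strong equation implies the weak one
    ([strong_weak]).

    Conversely, u in D_M satisfies the strong, hence also the weak equation for
    some continuous g, and it suffices to see that the weak equation has at most
    one continuous right-hand side ([weak_unique]).  Indicators of cylinders are
    continuous and have finite energy, and every cylinder contains a smaller one
    that avoids V_M ([subcylinder_avoiding_V]): make two consecutive letters
    differ beyond position M.  If f and g had the same integrals against these
    indicators and f(x) > g(x) held, then f - g would be bounded below by a
    positive constant near x, hence on such a small cylinder, which has positive
    measure: a contradiction ([le_of_weak_integrals]). *)

Set Implicit Arguments.
Unset Strict Implicit.
Unset Printing Implicit Defensive.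

Import Order.TTheory GRing.Theory Num.Theory.
Import numFieldNormedType.Exports.
Local Open Scope classical_set_scope.
Local Open Scope ring_scope.

(** * The vertex sets *)

Section Combinatorics.
Variables (N : nat) (N2 : (2 <= N)%N).
Local Notation Sigma := (shift_space N2).
Implicit Types (p q x : Sigma) (m j k M : nat).

Lemma subset_V i j : (i <= j)%N -> V i `<=` (V j : set Sigma).
Proof.
by move=> ij p Vp l jl; rewrite (Vp l (leq_trans ij jl)) (Vp j ij).
Qed.

(** The range kappa p <= j of the outer sum in H_m consists of the levels j such
    that p lies in V_j. *)
Lemma kappa_leq p m j : V m p -> (kappa p <= j)%N = `[< V j p >].
Proof.
move=> Vm; have ex : exists i, `[< V i p >] by exists m; apply/asboolP.
have [k /asboolP Vk kmin] := ex_minnP ex.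
suff -> : kappa p = k.
  apply/idP/asboolP => [kj|Vj]; first exact: subset_V Vk.
  by apply: kmin; apply/asboolP.
have hk : [set j | V j p /\ forall i, V i p -> (j <= i)%N] k.
  by split=> // i Vi; apply: kmin; apply/asboolP.
have [Vp pmin] : [set j | V j p /\ forall i, V i p -> (j <= i)%N] (kappa p).
  exact: (xgetI 0%N hk).
by apply/eqP; rewrite eqn_leq pmin// kmin//; apply/asboolP.
Qed.

(** The neighbour relation at level j: distinct points of V_j that agree on their
    first j letters. *)
Definition edge j p q : bool := `[< V j p /\ U p j q >].

Lemma edgeC j p q : edge j p q = edge j q p.
Proof.
have h x y : V j x /\ U x j y -> V j y /\ U y j x.
  by move=> [Vx [Vy yx e]]; split=> //; split=> // [/esym//|i /e ->].
by apply/asboolP/asboolP; exact: h.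
Qed.

(** A cylinder of length m + 1 contains at most one point of V_m. *)
Lemma V_cylinder_inj m p q : V m p -> V m q -> cylinder m.+1 p q -> q = p.
Proof.
move=> Vp Vq pq; apply/funext => i; have [im|mi] := leqP i m.
  by apply: pq; rewrite ltnS.
by rewrite (Vp _ (ltnW mi)) (Vq _ (ltnW mi)); apply: pq.
Qed.

(** The point of V_m in the cylinder of length m + 1 around x: the letter at
    position m is repeated forever. *)
Definition truncate m x : Sigma := fun i => x (minn i m).

Lemma truncate_V m x : V m (truncate m x).
Proof. by move=> i mi; rewrite /truncate (minn_idPr mi) minnn. Qed.

Lemma truncate_cylinder m x : cylinder m.+1 (truncate m x) x.
Proof. by move=> i; rewrite ltnS /truncate => /minn_idPl ->. Qed.

End Combinatorics.

(** * Symmetry of the difference operator and the energy of cylinder indicators *)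

Section Energy.
Variables (R : realType) (N : nat) (N2 : (2 <= N)%N).
Local Notation Sigma := (shift_space N2).
Implicit Types (p q x : Sigma) (u v f : Sigma -> R) (m j k M : nat).

Lemma H_edge m u p : V m p ->
  H m u p = \sum_(0 <= j < m.+1) \sum_(q \in (V m : set Sigma))
     (edge j p q)%:R * (u q - u p).
Proof.
move=> Vp; rewrite /H.
have km : (kappa p <= m.+1)%N.
  by rewrite (kappa_leq _ Vp); apply/asboolP; apply: subset_V Vp.
rewrite [RHS](@big_cat_nat _ _ _ (kappa p))//= [X in _ = X + _]big1_seq ?add0r.
  rewrite big_nat_cond [RHS]big_nat_cond; apply: eq_bigr => j.
  rewrite andbT (kappa_leq _ Vp) => /andP[/asboolP Vj jm].
  rewrite -[RHS](@fsbig_widen _ _ _ _ (U p j)).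
  - apply: eq_fsbigr => q /set_mem Uq.
    by rewrite /edge (_ : `[< _ >] = true) ?mul1r//; apply/asboolP.
  - by move=> q [Vq _ _]; exact: (@subset_V _ _ j m jm q Vq).
  - by move=> q [_ nU]/=; rewrite /edge; case: asboolP => [[]//|]; rewrite mul0r.
move=> j /andP[_]; rewrite mem_index_iota leq0n/= ltnNge (kappa_leq _ Vp).
move=> /asboolP nV; rewrite fsbig1// => q _.
by rewrite /edge; case: asboolP => [[]//|]; rewrite mul0r.
Qed.

Lemma sum_H_sym m u v :
  \sum_(p \in (V m : set Sigma)) (u p * H m v p) =
  \sum_(p \in (V m : set Sigma)) (v p * H m u p).
Proof.
have fV := @finite_V N N2 m.
pose F := fset_set (V m : set Sigma).
pose D (w : Sigma -> Sigma -> R) :=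
  \sum_(p <- F) \sum_(q <- F) \sum_(0 <= j < m.+1) (edge j p q)%:R * w p q.
have E (a b : Sigma -> R) : \sum_(p \in V m) (a p * H m b p) =
    D (fun p q => a p * b q) - D (fun p q => a p * b p).
  transitivity (D (fun p q => a p * b q - a p * b p)); last first.
    by do 3 (rewrite -sumrB; apply: eq_bigr => ? _); rewrite mulrBr.
  rewrite fsbig_finite//= big_seq_cond [RHS]big_seq_cond.
  apply: eq_bigr => p; rewrite andbT in_fset_set// => /set_mem Vp.
  rewrite (H_edge _ Vp) exchange_big/= big_distrr/=; apply: eq_bigr => j _.
  rewrite fsbig_finite//= big_distrr/=; apply: eq_bigr => q _.
  by rewrite -mulrBr mulrCA.
rewrite !{}E; congr (_ - _).
  rewrite [RHS]exchange_big; do 3 (apply: eq_bigr => ? _).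
  by rewrite edgeC [u _ * _]mulrC.
by do 3 (apply: eq_bigr => ? _); rewrite [u _ * _]mulrC.
Qed.

Lemma max_error_ge (mu : probability (borel_shift N2) R) u f m (A : set Sigma) p :
  finite_set A -> A p ->
  `|H m u p / fine (mu (cylinder m.+1 p)) - f p| <= max_error mu u f m A.
Proof.
move=> fA Ap; rewrite /max_error.
apply: (@le_bigmax_seq _ _ _ _ _ p xpredT
  (fun p => `|H m u p / fine (mu (cylinder m.+1 p)) - f p|)) => //.
by rewrite in_fset_set// inE.
Qed.

(** Neighbours at a level j >= k lie in the same cylinders of length k, so that
    only the levels below k contribute. *)
Lemma H_cylinder_indic k (w : Sigma) m p : V m p -> (k <= m)%N ->
  H m (\1_(cylinder k w)) p =
   if `[< V k p >] then H k (\1_(cylinder k w) : _ -> R) p else 0.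
Proof.
move=> Vp km.
have U0 j : (k <= j)%N ->
    \sum_(q \in U p j) ((\1_(cylinder k w) q : R) - \1_(cylinder k w) p) = 0.
  move=> kj; rewrite fsbig1// => q [_ _ qp]; apply/eqP; rewrite subr_eq0.
  rewrite !indicE; apply/eqP; congr (_%:R); congr nat_of_bool.
  have e i : (i < k)%N -> q i = p i by move=> ik; apply/qp/(leq_trans ik).
  apply/idP/idP; rewrite !inE => h i ik; first by rewrite -e// h.
  by rewrite e// h.
case: asboolP => [Vk|nV]; rewrite /H.
  rewrite (@big_cat_nat _ _ _ k.+1)//=; last first.
    by rewrite (kappa_leq _ Vp); apply/asboolP/(subset_V _ Vk).
  rewrite [X in _ + X = _]big_nat_cond [X in _ + X = _]big1 ?addr0// => j.
  by rewrite andbT => /andP[kj _]; apply: U0; exact: ltnW.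
rewrite big_nat_cond big1// => j; rewrite andbT => /andP[].
rewrite (kappa_leq _ Vp) => /asboolP Vj _; apply: U0.
by rewrite leqNgt; apply/negP => jk; apply/nV/(subset_V _ Vj)/ltnW.
Qed.

(** The energies of the indicator of a cylinder of length k are constant from
    level k on. *)
Lemma energy_cylinder_indic k (w : Sigma) m : (k <= m)%N ->
  energy_H m (\1_(cylinder k w)) (\1_(cylinder k w)) =
  energy_H k (\1_(cylinder k w)) (\1_(cylinder k w)) :> R.
Proof.
move=> km; rewrite /energy_H; congr (- _); apply/esym.
under [RHS]eq_fsbigr => p /set_mem Vp do rewrite (H_cylinder_indic _ Vp km).
rewrite -[RHS](@fsbig_widen _ _ _ _ (V k) (V m)).
- by apply: eq_fsbigr => p /set_mem Vk; case: asboolP.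
- exact: subset_V.
- by move=> p [_ nV] /=; case: asboolP => // _; rewrite mulr0.
Qed.

End Energy.

(** * Continuity, measurability and Riemann sums on the shift space *)

Section Topology.
Variables (R : realType) (N : nat) (N2 : (2 <= N)%N).
Local Notation Sigma := (shift_space N2).
Implicit Types (p x : Sigma) (f g : Sigma -> R) (m k : nat).

Lemma cvg_cylinder (y : nat -> Sigma) x :
  (forall k, cylinder k x (y k)) -> y n @[n --> \oo] --> x.
Proof.
move=> xy; apply/cvg_sup => i A /= [B [[C oC CB] Bx] BA].
exists i.+1 => // n /= ni; apply: BA; move: Bx; rewrite -CB /= /proj.
by rewrite (xy n).
Qed.

Lemma nbhs_cylinder x (A : set Sigma) :
  nbhs x A -> exists k, cylinder k x `<=` A.
Proof.
move=> xA; apply: contrapT => nk.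
have /choice[y xy] k : exists y, cylinder k x y /\ ~ A y.
  by apply: contrapT => ny; apply: nk; exists k => y xy;
     apply: contrapT => nA; apply: ny; exists y.
have [n _ nA] := @cvg_cylinder y x (fun k => (xy k).1) A xA.
by have [_] := xy n; apply; exact: (nA n (leqnn n)).
Qed.

Lemma open_cylinder k p : open (cylinder k p : set Sigma).
Proof.
elim: k => [|k IHk].
  by rewrite (_ : cylinder 0 p = setT); [exact: openT|apply/seteqP; split].
rewrite (_ : cylinder k.+1 p =
  cylinder k p `&` (fun x : Sigma => x k) @^-1` [set p k]).
  apply: openI => //.
  have pc : continuous (fun x : Sigma => x k : discrete_topology (symbol N2)).
    exact: (@proj_continuous _ (fun=> discrete_topology (symbol N2)) k).
  by move/continuousP : pc; apply; exact: discrete_open.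
apply/seteqP; split => [x xp|x [xp xk] i].
  by split; [move=> i ik; apply: xp; exact: ltnW|exact: xp].
by rewrite ltnS leq_eqVlt => /predU1P[->//|/xp].
Qed.

Lemma measurable_cylinder k p : measurable (cylinder k p : set (borel_shift N2)).
Proof. by apply: sub_sigma_algebra; exact: open_cylinder. Qed.

Lemma compact_shift_space : compact [set: Sigma].
Proof.
have fin (n : nat) : finite_set [set: discrete_topology (symbol N2)].
  exact: (@finite_finset 'I_N).
have := @tychonoff _ (fun _ : nat => discrete_topology (symbol N2)) _
  (fun n => finite_compact (fin n)).
set A := (X in compact X -> _).
by rewrite (_ : A = [set: Sigma])//; apply/seteqP; split.
Qed.

Lemma continuous_bounded f : continuous f ->
  exists2 K : R, 0 < K & forall x, `|f x| <= K.
Proof.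
move=> cf; have : compact (f @` setT).
  apply: continuous_compact compact_shift_space.
  exact: continuous_subspaceT.
move=> /compact_bounded [K [_ fK]]; exists (Num.max 1 (K + 1)).
  by rewrite lt_max ltr01.
move=> x; rewrite le_max; apply/orP; right.
by apply: fK => //; rewrite ltrDl.
Qed.

Lemma measurable_continuous f : continuous f ->
  measurable_fun [set: borel_shift N2] f.
Proof.
move=> /continuousP cf.
apply: (measurability _ (measurable_realfun.RGenOpens.measurableE R)).
move=> _ [_ [a [b ->] <-]]; rewrite setTI; apply: sub_sigma_algebra.
exact/cf/interval_open.
Qed.

Lemma continuous_cylinder_indic k p :
  continuous (\1_(cylinder k p) : Sigma -> R).
Proof.
move=> x.
have xk : \forall y \near x, (\1_(cylinder k p) y : R) = \1_(cylinder k p) x.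
  have : nbhs x (cylinder k x).
    by apply: open_nbhs_nbhs; split; [exact: open_cylinder|].
  apply: filterS => y xy; rewrite !indicE; congr (_%:R); congr nat_of_bool.
  apply/idP/idP; rewrite !inE => h i ik; first by rewrite -xy// h.
  by rewrite xy// h.
exact: (@cvg_near_cst Sigma R (\1_(cylinder k p) x)
  (\1_(cylinder k p) : Sigma -> R) (nbhs x) _ xk).
Qed.

Lemma continuous_mul f g : continuous f -> continuous g ->
  continuous (fun x => f x * g x).
Proof. by move=> cf cg x; exact: (@continuousM R Sigma f g x (cf x) (cg x)). Qed.

Lemma truncate_cvg x : truncate m x @[m --> \oo] --> x.
Proof.
by apply: cvg_cylinder => k i ik; rewrite /truncate (minn_idPl (ltnW ik)).
Qed.

Variable mu : probability (borel_shift N2) R.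

Lemma integrable_continuous f : continuous f ->
  mu.-integrable setT (EFin \o (f : borel_shift N2 -> R)).
Proof.
move=> cf; apply: measurable_bounded_integrable => //.
- exact: fin_num_fun_lty.
- exact: measurable_continuous.
have [K _ fK] := continuous_bounded cf.
exists K; split; [exact: num_real|] => r Kr x _; exact: le_trans (fK x) (ltW Kr).
Qed.

(** f composed with [truncate m] is a simple function on the cylinders of length
    m + 1. *)
Lemma truncate_simple f m x : f (truncate m x) =
  \sum_(p \in (V m : set Sigma)) f p * \1_(cylinder m.+1 p) x.
Proof.
have Vt : V m (truncate m x) by exact: truncate_V.
rewrite (fsbigD1 (truncate m x))//=; last first.
  exact: finite_V.
rewrite indicE mem_set ?mulr1; last exact: truncate_cylinder.
rewrite fsbig1 ?addr0// => p [Vp pt]; rewrite indicE memNset ?mulr0// => xp.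
apply: pt; apply: V_cylinder_inj Vt Vp _ => i im.
by rewrite -(xp i im); exact: (truncate_cylinder x im).
Qed.

Hypothesis mu_cylinder : forall m p, mu (cylinder m p) = (N%:R ^- m : R)%:E.

Lemma measurable_truncate f m : measurable_fun [set: borel_shift N2]
  (fun x : borel_shift N2 => f (truncate m x)).
Proof.
rewrite (_ : (fun x => _) = fun x : borel_shift N2 =>
   \sum_(p <- fset_set (V m : set Sigma)) f p * \1_(cylinder m.+1 p) x); last first.
  by apply/funext => x; rewrite truncate_simple fsbig_finite//; exact: finite_V.
apply: measurable_sum => p; apply: measurable_funM => //.
by apply: measurable_indic; exact: measurable_cylinder.
Qed.

Lemma integral_truncate f m :
  (\int[mu]_x (f (truncate m x))%:E =
   (\sum_(p \in (V m : set Sigma)) f p * N%:R ^- m.+1)%:E)%E.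
Proof.
have fV := @finite_V N N2 m.
rewrite (eq_integral (fun x : borel_shift N2 =>
   \sum_(p <- fset_set (V m : set Sigma)) (f p * \1_(cylinder m.+1 p) x)%:E)%E); last first.
  by move=> x _; rewrite truncate_simple fsbig_finite// sumEFin.
have ic p : continuous (fun x => f p * (\1_(cylinder m.+1 p) x : R)).
  exact: (continuous_mul (@cst_continuous Sigma R (f p))
            (@continuous_cylinder_indic m.+1 p)).
rewrite integral_sum//; last by move=> p; exact: (integrable_continuous (@ic p)).
rewrite fsbig_finite//= -sumEFin; apply: eq_bigr => p _.
under eq_integral do rewrite EFinM.
rewrite integralZl//; last first.
  exact: integrable_continuous (@continuous_cylinder_indic m.+1 p).
rewrite (integral_indic mu measurableT (measurable_cylinder m.+1 p)).
rewrite setIT EFinM.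
by congr (_ * _)%E; exact: mu_cylinder.
Qed.

(** The sums over V_m are the integrals of f composed with [truncate m], which
    converges pointwise to f and is dominated by sup |f|. *)
Lemma riemann_sum_cvg f : continuous f ->
  (\sum_(p \in (V m : set Sigma)) f p * N%:R ^- m.+1)%:E @[m --> \oo] -->
  (\int[mu]_x (f x)%:E)%E.
Proof.
move=> cf; have [K K0 fK] := continuous_bounded cf.
under eq_fun do rewrite -integral_truncate.
have [] := @dominated_convergence _ _ R mu setT measurableT
  (fun m x => (f (truncate m x))%:E) (EFin \o f) (cst K%:E) => //.
- by move=> m; apply/measurable_EFinP; exact: measurable_truncate.
- by apply/measurable_EFinP; exact: measurable_continuous.
- apply: aeW => x _ /=; apply: cvg_EFin; first exact: nearW.
  exact: (cvg_comp _ _ (@truncate_cvg x) (cf x)).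
- exact: finite_measure_integrable_cst.
- by apply: aeW => x n _ /=; rewrite lee_fin.
Qed.

End Topology.

(** * The strong and the weak equation *)

Section WeakStrong.
Variables (R : realType) (N : nat) (N2 : (2 <= N)%N).
Local Notation Sigma := (shift_space N2).
Implicit Types (p x : Sigma) (u v f g : Sigma -> R) (m k M : nat).
Variable mu : probability (borel_shift N2) R.
Hypothesis mu_cylinder : forall m p, mu (cylinder m p) = (N%:R ^- m : R)%:E.

Lemma sum_cylinder_measure m :
  \sum_(p \in (V m : set Sigma)) (N%:R ^- m.+1 : R) = 1.
Proof.
apply: EFin_inj.
transitivity (\int[mu]_x ((cst 1%R : Sigma -> R) (truncate m x))%:E)%E.
  rewrite (integral_truncate mu_cylinder); congr (_%:E).
  by apply: eq_fsbigr => p _; rewrite mul1r.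
rewrite (integral_cst mu measurableT 1%:E) mul1e.
exact: probability_setT.
Qed.

(** The distance of the level-m energy from minus the Riemann sum of f v; the
    points of V_M drop out because v vanishes there. *)
Lemma energy_error M u v f m K : (forall x, `|v x| <= K) ->
  (forall p, V M p -> v p = 0) ->
  `|energy_H m u v + \sum_(p \in (V m : set Sigma)) (f p * v p) * N%:R ^- m.+1|
    <= K * max_error mu u f m (V m `\` V M).
Proof.
move=> vK v0; have fV := @finite_V N N2 m.
have K0 : 0 <= K by apply: le_trans (vK point).
rewrite /energy_H sum_H_sym addrC.
set e := max_error _ _ _ _ _.
rewrite -[K * e]mulr1 -[X in _ <= _ * X](sum_cylinder_measure m).
rewrite !fsbig_finite//= -sumrB.
rewrite (le_trans (ler_norm_sum _ _ _))// mulr_sumr.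
rewrite big_seq_cond [leRHS]big_seq_cond.
apply: ler_sum => p; rewrite andbT in_fset_set// => /set_mem Vp.
have N0 : (0 : R) < N%:R ^- m.+1.
  by rewrite invr_gt0 exprn_gt0// ltr0n (ltnW N2).
have [VM|nVM] := pselect (V M p).
  rewrite (v0 _ VM) mulr0 !mul0r subrr normr0 !mulr_ge0 ?(ltW N0)//.
  exact: bigmax_ge_id.
have e1 : `|H m u p / fine (mu (cylinder m.+1 p)) - f p| <= e.
  by apply: max_error_ge => //; exact: finite_setD.
rewrite mu_cylinder/= in e1.
rewrite (_ : _ - _ = - (v p * (H m u p / N%:R ^- m.+1 - f p) * N%:R ^- m.+1)).
  rewrite normrN !normrM (gtr0_norm N0) ler_pM2r//.
  by apply: ler_pM.
rewrite mulrBr mulrBl opprB; congr (_ - _); first by rewrite [v p * f p]mulrC.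
by rewrite mulrA mulfVK// gt_eqF.
Qed.

Lemma strong_weak M u f : continuous f ->
  strong_laplacian_eq mu M u f -> weak_laplacian_eq mu M u f.
Proof.
move=> cf uf v [[cv _] v0].
have [K K0 vK] := continuous_bounded cv.
have cfv := continuous_mul cf cv.
have [I IE] : exists I : R, (\int[mu]_x (f x * v x)%:E = I%:E)%E.
  exists (fine (\int[mu]_x (f x * v x)%:E)%E); apply/esym/fineK.
  exact: (integrable_fin_num measurableT (integrable_continuous mu cfv)).
have := riemann_sum_cvg mu_cylinder cfv; rewrite IE => /fine_cvg/= Rcvg.
rewrite /energy; apply/cvg_lim => //.
apply: cvg_EFin; first exact: nearW.
(* The energy is the error term minus the Riemann sum. *)
rewrite [X in X @ _ --> _](_ : _ = fun m =>
   (energy_H m u v +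
    \sum_(p \in (V m : set Sigma)) (f p * v p) * N%:R ^- m.+1) -
   \sum_(p \in (V m : set Sigma)) (f p * v p) * N%:R ^- m.+1); last first.
  by apply/funext => m /=; rewrite addrK.
rewrite -[- I]add0r; apply: cvgB => //.
apply/norm_cvg0P.
apply: (@squeeze_cvgr _ _ _ _ (cst 0)
  (fun m => K * max_error mu u f m (V m `\` V M))).
- by apply: nearW => m; rewrite normr_ge0/= (energy_error u f m vK v0).
- exact: cvg_cst.
- by rewrite -[0](mulr0 K); apply: cvgM; [exact: cvg_cst|exact: uf].
Qed.

Lemma cylinder_indic_dom_energy k p :
  dom_energy (\1_(cylinder k p) : Sigma -> R).
Proof.
split; first exact: continuous_cylinder_indic.
pose chi : Sigma -> R := \1_(cylinder k p).
rewrite /energy (_ : limn _ = (energy_H k chi chi)%:E).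
  exact: ltry.
apply/cvg_lim => //; apply: cvg_near_cst.
by exists k => // m /= km; rewrite energy_cylinder_indic.
Qed.

Lemma subcylinder_avoiding_V M k x : exists l w,
  cylinder l w `<=` cylinder k x /\ forall p, V M p -> ~ cylinder l w p.
Proof.
(* The letters of w at positions l and l + 1 differ, whereas points of V_M are
   constant from position M <= l on. *)
pose a : symbol N2 := Ordinal (ltnW N2); pose b : symbol N2 := Ordinal N2.
pose l := maxn k M.
exists l.+2, (fun i => if (i < l)%N then x i else if i == l then a else b).
split => [y yw i ik|p Vp pw].
  have il : (i < l)%N by rewrite leq_max ik.
  by rewrite yw ?il// ltnS ltnW// ltnS ltnW.
have := pw l (ltnW (ltnSn _)); have := pw l.+1 (ltnSn _).
rewrite ltnn eqxx ltnNge leqnSn/= gtn_eqF//.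
rewrite (Vp l.+1) ?(Vp l) ?leq_maxr// => [->|]; first by move/(congr1 val).
exact: leq_trans (leq_maxr _ _) (leqnSn _).
Qed.

Lemma le_of_weak_integrals M f g : continuous f -> continuous g ->
  (forall v, dom_energy_ M v ->
     (\int[mu]_x (f x * v x)%:E = \int[mu]_x (g x * v x)%:E)%E) ->
  forall x, f x <= g x.
Proof.
move=> cf cg fg x; rewrite leNgt; apply/negP => gfx.
(* Half of the gap at x: f - g still exceeds e on a neighbourhood of x. *)
pose e := (f x - g x) / 2.
have e0 : 0 < e by rewrite divr_gt0 ?subr_gt0.
have near_x : nbhs x [set y | e < f y - g y].
  have /cvgr_gt : (fun y => f y - g y) @ x --> f x - g x.
    exact: cvgB (cf x) (cg x).
  by apply; rewrite /e ltr_pdivrMr// ltr_pMr ?ltr1n// subr_gt0.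
have [k kx] := nbhs_cylinder near_x.
have [l [w [wx wM]]] := subcylinder_avoiding_V M k x.
pose v : Sigma -> R := \1_(cylinder l w).
have cv : continuous v := @continuous_cylinder_indic _ _ _ l w.
have domv : dom_energy_ M v.
  split; first exact: cylinder_indic_dom_energy.
  by move=> p /wM pw; rewrite /v indicE memNset.
have ig := integrable_continuous mu (continuous_mul cg cv).
have iff := integrable_continuous mu (continuous_mul cf cv).
have ie := integrable_continuous mu
  (continuous_mul (@cst_continuous Sigma R e) cv).
have := fg _ domv; apply/eqP; rewrite gt_eqF//.
apply: (@lt_le_trans _ _ (\int[mu]_x ((g x * v x)%:E + (e * v x)%:E))%E).
  rewrite integralD//= lteDl; last exact: integrable_fin_num.
  under eq_integral do rewrite EFinM.
  rewrite integralZl//; last exact: (integrable_continuous mu cv).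
  rewrite (integral_indic mu measurableT (measurable_cylinder l w)) setIT.
  rewrite mule_gt0 ?lte_fin//.
  have -> : (mu : measure _ _) (cylinder l w) = (N%:R ^- l)%:E := mu_cylinder l w.
  by rewrite lte_fin invr_gt0 exprn_gt0// ltr0n (ltnW N2).
apply: le_integral => //; first exact: integrableD.
move=> y _; rewrite -EFinD lee_fin -mulrDl /v indicE.
have [/set_mem wy|] := boolP (y \in cylinder l w); last by rewrite !mulr0.
by rewrite !mulr1 -lerBrDl ltW//; apply: kx; exact: wx.
Qed.

Lemma weak_unique M u f g : continuous f -> continuous g ->
  weak_laplacian_eq mu M u f -> weak_laplacian_eq mu M u g -> f = g.
Proof.
move=> cf cg uf ug; have fg v : dom_energy_ M v ->
    (\int[mu]_x (f x * v x)%:E = \int[mu]_x (g x * v x)%:E)%E.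
  by move=> vM; apply: oppe_inj; rewrite -uf// -ug.
apply/funext => x; apply/eqP; rewrite eq_le.
rewrite (le_of_weak_integrals cf cg fg)/=.
by apply: (le_of_weak_integrals cg cf) => v /fg.
Qed.

End WeakStrong.

Theorem theorem4p4 (R : realType) (N : nat) (N2 : (2 <= N)%N)
    (mu : probability (borel_shift N2) R)
    (mu_cylinder : forall (m : nat) (p : shift_space N2),
        mu (cylinder m p) = ((N%:R ^- m : R)%:E))
    (M : nat) (u f : shift_space N2 -> R) :
  D_ mu M u -> continuous f ->
  (strong_laplacian_eq mu M u f <-> weak_laplacian_eq mu M u f).
Proof.
move=> [_ [g [cg _ ug]]] cf; split; first exact: strong_weak.
move=> uf; rewrite (weak_unique mu_cylinder cf cg uf)//.
exact: strong_weak.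
Qed.
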